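(* Let $p\in[0,1]$, $q=1-p$, let $(x_j)_{j\ge1}$ be independent and identically distributed $\mathrm{Bern}(p)$ random variables, and let $\mathcal T_n^{\mathrm B}=\mathcal T_n^{\mathrm B}(x_1,\ldots,x_n)$ be the associated simple butterfly tree. Then $$\frac{\operatorname{HS}(\mathcal T_n^{\mathrm B})}{n}\longrightarrow\mu_p=\frac{pq}{1-pq}\quad\text{in probability as } n\to\infty.$$
   Context: A rooted binary tree is a finite nonempty rooted tree in which each node has at most one left child and at most one right child. The Horton--Strahler (HS) number of a node $v$ is: $0$ if $v$ has no children; the HS number of the child if $v$ has exactly one child; and $\max(\operatorname{HS}(v_\ell),\operatorname{HS}(v_r))+\mathbf 1_{\{\operatorname{HS}(v_\ell)=\operatorname{HS}(v_r)\}}$ if $v$ has children $v_\ell,v_r$. $\operatorname{HS}(\mathcal T)$ is the HS number of the root of $\mathcal T$. $\mathcal T_1\oplus\mathcal T_2$ is obtained by making the root of $\mathcal T_2$ the right child of the last node of the path from the root of $\mathcal T_1$ that always moves to the right child; $\mathcal T_1\ominus\mathcal T_2$ is obtained by making the root of $\mathcal T_2$ the left child of the last node of the path from the root of $\mathcal T_1$ that always moves to the left child. Simple butterfly trees: for a bitstring $\mathbf x=(x_1,\ldots,x_n)\in\{0,1\}^n$, the simple butterfly tree $\mathcal T_n^{\mathrm B}(\mathbf x)$, with $2^n$ nodes, is defined recursively: $\mathcal T_0^{\mathrm B}$ (empty string) is a single node, and with $\mathcal S=\mathcal T_{n-1}^{\mathrm B}(x_1,\ldots,x_{n-1})$, $\mathcal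 T_n^{\mathrm B}(\mathbf x)$ is $\mathcal S\oplus\mathcal S$ if $x_n=0$ and $\mathcal S\ominus\mathcal S$ if $x_n=1$ (two identical copies of $\mathcal S$). *)

(* Defs.v *)
From HB Require Import structures.
From mathcomp Require Import all_boot all_order all_algebra finmap.
From mathcomp Require Import all_classical all_reals all_analysis.

Set Implicit Arguments.
Unset Strict Implicit.
Unset Printing Implicit Defensive.
Import Order.TTheory GRing.Theory Num.Theory.
Import numFieldNormedType.Exports.

(* Finite nonempty rooted binary trees: [Node l r] has left child [l] and
   right child [r], where [None] means that the child is absent. *)
Inductive bintree : Type := Node of option bintree & option bintree.

Fixpoint HS (t : bintree) : nat :=
  match t with
  | Node None None => 0
  | Node (Some l) None => HS l
  | Node None (Some r) => HS r
  | Node (Some l) (Some r) => maxn (HS l) (HS r) + (HS l == HS r)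
  end.

Fixpoint oplus (t1 t2 : bintree) : bintree :=
  match t1 with
  | Node l None => Node l (Some t2)
  | Node l (Some r) => Node l (Some (oplus r t2))
  end.

Fixpoint ominus (t1 t2 : bintree) : bintree :=
  match t1 with
  | Node None r => Node (Some t2) r
  | Node (Some l) r => Node (Some (ominus l t2)) r
  end.

(* [foldl] consumes the bits from x_1 to x_n, so that the last bit decides the
   outermost operation; see [butterfly_rcons]. *)
Definition butterfly (x : seq bool) : bintree :=
  foldl (fun S b => if b then ominus S S else oplus S S) (Node None None) x.

Lemma butterfly_rcons (x : seq bool) (b : bool) :
  butterfly (rcons x b) =
  if b then ominus (butterfly x) (butterfly x)
  else oplus (butterfly x) (butterfly x).
Proof. by rewrite /butterfly foldl_rcons. Qed.

Local Open Scope classical_set_scope.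
Local Open Scope ring_scope.

(* Mutual independence: the product rule for every finite subfamily. *)
Definition mutually_independent (R : realType) (d d' : measure_display)
    (Omega : measurableType d) (T : measurableType d')
    (P : probability Omega R) (I : choiceType)
    (X : I -> {RV P >-> T}) : Prop :=
  forall (J : {fset I}) (A : I -> set T),
    (forall i, measurable (A i)) ->
    P (\bigcap_(i in [set` J]) (X i @^-1` A i)) =
    (\prod_(i <- J) P (X i @^-1` A i))%E.

Definition cvg_in_probability (R : realType) (d : measure_display)
    (Omega : measurableType d) (P : probability Omega R)
    (Y : nat -> Omega -> R) (Z : Omega -> R) : Prop :=
  forall eps : R, 0 < eps ->
    P [set w | eps < `|Y n w - Z w|] @[n --> \oo] --> 0%E.

(* Main.v *)
Require Import Defs.
From HB Require Import structures.
From mathcomp Require Import all_boot all_order all_algebra finmap.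
From mathcomp Require Import all_classical all_reals all_analysis.
From mathcomp Require Import ring lra.
Import Order.TTheory GRing.Theory Num.Theory.
Import numFieldNormedType.Exports.
Set Implicit Arguments.
Unset Strict Implicit.
Unset Printing Implicit Defensive.

(* The HS number increases under [S |-> S (+) S] exactly when some left subtree
   hanging off the right spine of S has the same HS number as S (symmetrically
   for the left spine). Following this condition along the bits gives a Markov
   chain with three states: right after an increase the first bit b is recorded,
   further bits b change nothing, and the first bit different from b increases
   the HS number by one and restarts the cycle. Solving the Poisson equation of
   this chain turns HS(T_n) - n mu_p, up to a bounded term, into a martingale with
   bounded increments, whose second moment is O(n); Chebyshev's inequality
   concludes. *)

(** * Mirror images and HS numbers along spines *)

Fixpoint mirror (t : bintree) : bintree :=
  let: Node l r := t in
  Node (if r is Some r' then Some (mirror r') else None)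
       (if l is Some l' then Some (mirror l') else None).

Fixpoint bintree_nested_ind (Q : bintree -> Prop)
  (IH : forall l r, (if l is Some l' then Q l' else True) ->
     (if r is Some r' then Q r' else True) -> Q (Node l r)) (t : bintree) : Q t.
Proof.
case: t => l r; apply: (IH).
- by case: l => // l; exact: (bintree_nested_ind Q IH l).
- by case: r => // r; exact: (bintree_nested_ind Q IH r).
Defined.

Lemma mirrorK : involutive mirror.
Proof.
by elim/bintree_nested_ind => -[l|] [r|] //= IHl IHr; rewrite ?IHl ?IHr.
Qed.

Lemma HS_mirror t : HS (mirror t) = HS t.
Proof.
elim/bintree_nested_ind: t => -[l|] [r|] //= IHl IHr.
by rewrite IHl IHr maxnC eq_sym.
Qed.

Lemma mirror_oplus t s : mirror (oplus t s) = ominus (mirror t) (mirror s).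
Proof.
elim/bintree_nested_ind: t => l [r|] //= _ IHr.
by rewrite IHr.
Qed.

Lemma mirror_ominus t s : mirror (ominus t s) = oplus (mirror t) (mirror s).
Proof. by rewrite -[RHS]mirrorK mirror_oplus !mirrorK. Qed.

Fixpoint right_spine_lt h (t : bintree) : bool :=
  let: Node l r := t in
  (if l is Some l' then HS l' < h else true) &&
  (if r is Some r' then right_spine_lt h r' else true).

Definition left_spine_lt h t := right_spine_lt h (mirror t).

Lemma right_spine_lt_leq h k t :
  h <= k -> right_spine_lt h t -> right_spine_lt k t.
Proof.
move=> hk; elim/bintree_nested_ind: t => l r _ IHr /= /andP[hl hr].
apply/andP; split; first by case: l hl => // l /leq_trans; apply.
by case: r IHr hr.
Qed.

Lemma right_spine_lt_oplus h t s :
  right_spine_lt h (oplus t s) = right_spine_lt h t && right_spine_lt h s.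
Proof.
elim/bintree_nested_ind: t => l [r|] /= _ IHr; last by rewrite andbT.
by rewrite IHr andbA.
Qed.

(** Walking up the right spine from the grafted [s], each left subtree is strictly below the value
    [HS s] coming from the right, so no tie ever occurs. *)
Lemma HS_oplus t s : right_spine_lt (HS s) t -> HS (oplus t s) = HS s.
Proof.
elim/bintree_nested_ind: t => l [r|] /= _ IHr => [/andP[hl hr]|/andP[hl _]].
  case: l hl => [l|]; rewrite IHr // => hl.
  by rewrite (maxn_idPr (ltnW hl)) (ltn_eqF hl) addn0.
case: l hl => [l hl|] //.
by rewrite (maxn_idPr (ltnW hl)) (ltn_eqF hl) addn0.
Qed.

(** * The three-state chain and its invariant *)

(* [None] is the state right after the HS number has increased (or at the
   start), [Some b] means that only bits [b] have been read since then. *)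
Definition hs_step (hc : nat * option bool) (b : bool) : nat * option bool :=
  match hc with
  | (h, None) => (h, Some b)
  | (h, Some c) => if b == c then (h, Some c) else (h.+1, None)
  end.

Definition hs_run (s : seq bool) := foldl hs_step (0, None) s.

(* What is known about the HS number of the butterfly tree and about the subtrees
   hanging off its spines, after the state [None] and [Some false] respectively;
   [Some true] is the mirror image of [Some false]. *)
Definition hs_inv_none h t :=
  [&& HS t == h, right_spine_lt h t & left_spine_lt h t].

Definition hs_inv_false h t :=
  [&& HS t == h, right_spine_lt h t &
   let: Node l r := t in
   (if r is Some r' then HS r' == h else false) &&
   (if l is Some l' then left_spine_lt h l' else true)].

Definition hs_inv (hc : nat * option bool) t :=
  match hc.2 with
  | None => hs_inv_none hc.1 t
  | Some false => hs_inv_false hc.1 t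
  | Some true => hs_inv_false hc.1 (mirror t)
  end.

Lemma hs_inv_none_mirror h t : hs_inv_none h (mirror t) = hs_inv_none h t.
Proof.
by rewrite /hs_inv_none /left_spine_lt mirrorK HS_mirror (andbC (right_spine_lt _ t)).
Qed.

(** The copy goes to the end of the right spine, so the right child of the result contains it and
    has HS number [h], while the left child is unchanged. *)
Lemma hs_inv_false_oplus h l r : let t := Node l r in
  HS t = h -> right_spine_lt h t ->
  (if l is Some l' then left_spine_lt h l' else true) ->
  hs_inv_false h (oplus t t).
Proof.
move=> t ht rt lt; rewrite /hs_inv_false right_spine_lt_oplus rt HS_oplus ?ht //.
rewrite eqxx /=; case: r @t ht rt lt => [r|] t ht /andP[_ rr] lt /=.
  by rewrite HS_oplus ht // eqxx.
by rewrite lt andbT; apply/eqP.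
Qed.

Lemma hs_inv_none_oplus h t :
  hs_inv_none h t -> hs_inv_false h (oplus t t).
Proof.
case: t => l r /and3P[/eqP ht rt] /andP[_ lt].
by apply: hs_inv_false_oplus => //; case: l lt {ht rt}.
Qed.

Lemma hs_inv_false_oplus_self h t :
  hs_inv_false h t -> hs_inv_false h (oplus t t).
Proof.
case: t => l r /and3P[/eqP ht rt] /andP[_ lt].
exact: hs_inv_false_oplus.
Qed.

(** The grafted copy gives the root a left child of HS number [h], which ties with the right child.
    The subtrees hanging off both spines stay below the new value [h.+1]. *)
Lemma hs_inv_false_ominus h t :
  hs_inv_false h t -> hs_inv_none h.+1 (ominus t t).
Proof.
case: t => l [r|]; rewrite /hs_inv_false ?andbF //.
set t := Node _ _ => /and3P[/eqP ht /andP[hl rr]] /andP[/eqP hr lt].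
have [l' -> [hl' ll']] : exists2 l', ominus t t = Node (Some l') (Some r) &
    HS l' = h /\ left_spine_lt h.+1 l'.
  have lt1 : left_spine_lt h.+1 t.
    rewrite /left_spine_lt /= HS_mirror hr ltnSn /=.
    by case: l {t ht hl} lt => // l; exact: right_spine_lt_leq.
  case: l @t ht hl lt lt1 => [l|] t ht hl lt lt1.
    exists (ominus l t) => //.
    rewrite -HS_mirror /left_spine_lt mirror_ominus HS_oplus ?HS_mirror ?ht //.
    by rewrite right_spine_lt_oplus -/(left_spine_lt _ t) lt1 (right_spine_lt_leq _ lt).
  by exists t.
apply/and3P; split.
- by rewrite /= hl' hr maxnn eqxx addn1.
- by rewrite /= hl' ltnSn (right_spine_lt_leq _ rr).
- by rewrite /left_spine_lt /= HS_mirror hr ltnSn.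
Qed.

Lemma hs_invP s : hs_inv (hs_run s) (butterfly s).
Proof.
elim/last_ind: s => // s b; rewrite butterfly_rcons /hs_run foldl_rcons.
(* Of the six cases, those from [Some true], and from [None] with bit 1, follow by mirroring. *)
rewrite -/(hs_run s); case: (hs_run s) => h [[]|]; case: b; rewrite /hs_inv /=.
- by rewrite mirror_ominus; exact: hs_inv_false_oplus_self.
- by move=> /hs_inv_false_ominus; rewrite -mirror_oplus hs_inv_none_mirror.
- exact: hs_inv_false_ominus.
- exact: hs_inv_false_oplus_self.
- rewrite -hs_inv_none_mirror mirror_ominus; exact: hs_inv_none_oplus.
- exact: hs_inv_none_oplus.
Qed.

Lemma HS_butterfly s : HS (butterfly s) = (hs_run s).1.
Proof.
have := hs_invP s; rewrite /hs_inv; case: (hs_run s) => h [[]|] /and3P[/eqP] //=.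
by rewrite HS_mirror.
Qed.

(** * Expectations over independent Bernoulli bits *)

Local Open Scope classical_set_scope.
Local Open Scope ring_scope.

(** The last bit is averaged first, which amounts to conditioning on the earlier bits. *)
Fixpoint bernoulli_mean (R : realType) (p : R) (n : nat) (F : seq bool -> R) : R :=
  if n is m.+1 then
    bernoulli_mean p m (fun s => p * F (rcons s true) + (1 - p) * F (rcons s false))
  else F [::].

Lemma bernoulli_mean_le (R : realType) (p : R) n (F G : seq bool -> R) :
  0 <= p <= 1 -> (forall s, size s = n -> F s <= G s) ->
  bernoulli_mean p n F <= bernoulli_mean p n G.
Proof.
move=> /andP[p0 p1]; elim: n F G => [|n IH] F G FG /=; first exact: FG.
apply: IH => s sn.
by rewrite lerD // ler_wpM2l ?subr_ge0 // FG // size_rcons sn.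
Qed.

Lemma bernoulli_mean_linear (R : realType) (p a b : R) n (F G : seq bool -> R) :
  bernoulli_mean p n (fun s => a * F s + b * G s) =
  a * bernoulli_mean p n F + b * bernoulli_mean p n G.
Proof.
elim: n F G => //= n IH F G; rewrite -IH; congr bernoulli_mean.
by apply/funext => s; ring.
Qed.

Lemma bernoulli_mean_cst (R : realType) (p a : R) n :
  bernoulli_mean p n (fun=> a) = a.
Proof.
elim: n => //= n IH; rewrite -[RHS]IH; congr bernoulli_mean.
by apply/funext => s; ring.
Qed.

Lemma probability_mkseq (R : realType) (d : measure_display)
    (Omega : measurableType d) (P : probability Omega R) (p : R)
    (x : nat -> {RV P >-> bool}) (n : nat) (phi : pred (seq bool)) :
  0 <= p <= 1 -> mutually_independent x ->
  (forall j : nat, distribution P (x j) =1 bernoulli_prob p) ->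
  P [set w | phi (mkseq (fun j => x j w) n)] =
  (bernoulli_mean p n (fun s => (phi s)%:R))%:E.
Proof.
move=> p01 indep distx.
(* Carrying the values [c] of the next bits along lets the induction split off
   the last bit of the prefix, so that independence is only used for points. *)
pose E n phi c := [set w | phi (mkseq (fun j => x j w) n) /\
  mkseq (fun j => x (n + j)%N w) (size c) = c].
suff /(_ n phi [::])[_] : forall n (phi : pred (seq bool)) c,
    measurable (E n phi c) /\ P (E n phi c) =
    (bernoulli_mean p n (fun s => (phi s)%:R) * \prod_(b <- c) bernoulli_pmf p b)%:E.
  rewrite big_nil mulr1 => <-; congr (P _); apply/seteqP.
  by split => [w|w []].
move=> {phi} {}n; elim: n => [|n IH] phi c; last first.
  have EU : E n.+1 phi c =
      E n (fun s => phi (rcons s true)) (true :: c) `|`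
      E n (fun s => phi (rcons s false)) (false :: c).
    have shift w : mkseq (fun j => x (n + j)%N w) (size c).+1 =
        x n w :: mkseq (fun j => x (n.+1 + j)%N w) (size c).
      rewrite /mkseq /= addn0; congr (_ :: _).
      by rewrite (iotaDl 1 0) -map_comp; apply/eq_map => j /=; rewrite addnA addn1.
    apply/seteqP; split => w; rewrite /E /= !shift mkseqS.
      by case=> ph ->; case: (x n w) ph; [left | right].
    by case=> -[ph [-> ->]].
  have [mt Pt] := IH (fun s => phi (rcons s true)) (true :: c).
  have [mf Pf] := IH (fun s => phi (rcons s false)) (false :: c).
  split; first by rewrite EU; exact: measurableU.
  rewrite EU measureU //; last first.
    rewrite -subset0 => w [[_]] /=.
    by case=> xt _ [_ [xf _]]; rewrite xt in xf.
  rewrite [X in (X + _)%E]Pt [X in (_ + X)%E]Pf -EFinD !big_cons /bernoulli_pmf /=.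
  by congr EFin; rewrite bernoulli_mean_linear; ring.
pose J := [fset i in iota 0 (size c)]%fset.
(* The default [false] beyond [size c] is harmless: only indices in [J] are intersected. *)
pose A i := [set nth false c i].
have E0 : E 0 phi c =
    if phi [::] then \bigcap_(i in [set` J]) (x i @^-1` A i) else set0.
  apply/seteqP; split => w; rewrite /E /=; case: (phi [::]) => //=.
  - case=> _ cE i /=; rewrite inE /= mem_iota => ic.
    by rewrite /A /= -[in RHS]cE nth_mkseq.
  - by case.
  - move=> xc; split => //; apply: (@eq_from_nth _ false); rewrite size_mkseq // => i ic.
    by rewrite nth_mkseq // add0n; apply: xc; rewrite /= inE mem_iota.
have mA i : measurable (x i @^-1` A i).
  by rewrite -[_ @^-1` _]setTI; exact: measurable_funP.
have PA i : P (x i @^-1` A i) = (bernoulli_pmf p (nth false c i))%:E.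
  rewrite -[LHS]/(distribution P (x i) (A i)) distx /bernoulli_prob p01.
  by rewrite fsbig_set1.
split.
  rewrite E0; case: (phi [::]) => //.
  by apply: fin_bigcap_measurable => //; exact: finite_finset.
rewrite E0 /=; case: (phi [::]); last by rewrite measure0 mul0r.
rewrite indep //= mul1r (perm_big (iota 0 (size c))) /=.
  rewrite (eq_bigr _ (fun i _ => PA i)) prodEFin.
  by rewrite [in RHS](big_nth false) /index_iota subn0.
by apply: uniq_perm => [||i]; rewrite ?fset_uniq ?iota_uniq // inE.
Qed.

(** * The martingale and its second moment *)

(** For [0 < p < 1] and [q = 1 - p], this is the reciprocal of the mean cycle length
    [1 + p/q + q/p]. *)
Definition hs_rate (R : realType) (p : R) := p * (1 - p) / (1 - p * (1 - p)).

(* Solution g of the Poisson equation of the chain: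
   E[increase of HS + g(next state)] = mu_p + g(current state). *)
Definition hs_potential (R : realType) (p : R) (c : option bool) :=
  if c is Some b then 1 - bernoulli_pmf p b / (1 - p * (1 - p)) else 0.

Definition hs_martingale (R : realType) (p : R) (s : seq bool) : R :=
  (hs_run s).1%:R - hs_rate p * (size s)%:R + hs_potential p (hs_run s).2.

Lemma hs_denominator_gt0 (R : realType) (p : R) : 0 < 1 - p * (1 - p).
Proof. by have := sqr_ge0 (2 * p - 1); lra. Qed.

Lemma hs_rate_bounds (R : realType) (p : R) : 0 <= p <= 1 -> 0 <= hs_rate p <= 1.
Proof.
move=> /andP[p0 p1]; have D0 := hs_denominator_gt0 p.
have pq0 : 0 <= p * (1 - p) by rewrite mulr_ge0 // subr_ge0.
rewrite /hs_rate divr_ge0 ?(ltW D0) // ler_pdivrMr //= mul1r.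
by have := sqr_ge0 (2 * p - 1); lra.
Qed.

Lemma hs_potential_bounds (R : realType) (p : R) c :
  0 <= p <= 1 -> -1 <= hs_potential p c <= 1.
Proof.
move=> /andP[p0 p1]; have D0 := hs_denominator_gt0 p.
case: c => [b|] /=; last by rewrite lerN10 ler01.
suff: 0 <= bernoulli_pmf p b / (1 - p * (1 - p)) <= 2 by lra.
rewrite divr_ge0 ?(ltW D0) ?bernoulli_pmf_ge0 ?p0 // ler_pdivrMr //=.
by case: b => /=; have := sqr_ge0 (2 * p - 1); nra.
Qed.

(** The increment [D] has conditional mean zero and absolute value at most 3, so the cross term
    vanishes and only its second moment is added. *)
Lemma hs_martingale_sqr_step (R : realType) (p : R) (s : seq bool) :
  0 <= p <= 1 ->
  p * hs_martingale p (rcons s true) ^+ 2 +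
  (1 - p) * hs_martingale p (rcons s false) ^+ 2 <= hs_martingale p s ^+ 2 + 9.
Proof.
move=> p01; pose D b := hs_martingale p (rcons s b) - hs_martingale p s.
(* This is the Poisson equation, checked in each state. *)
have Dmean : p * D true + (1 - p) * D false = 0.
  have D0 : 1 - p * (1 - p) != 0 by rewrite gt_eqF ?hs_denominator_gt0.
  rewrite /D /hs_martingale !size_rcons /hs_run !foldl_rcons -/(hs_run s).
  rewrite /hs_rate /hs_potential /bernoulli_pmf.
  by case: (hs_run s) => h [[]|] /=; rewrite -!natr1; field.
have Dle b : D b ^+ 2 <= 9.
  (* The HS increment minus the rate lies in [[-1, 1]], the change of potential in [[-2, 2]]. *)
  suff: -3 <= D b <= 3 by nra.
  have := hs_rate_bounds p01.
  rewrite /D /hs_martingale size_rcons /hs_run foldl_rcons -/(hs_run s).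
  case: (hs_run s) => h c; have := hs_potential_bounds c p01.
  have := hs_potential_bounds (hs_step (h, c) b).2 p01.
  have : (hs_step (h, c) b).1 = h \/ (hs_step (h, c) b).1 = h.+1.
    by case: c => [c|] /=; [case: ifP; [left|right]|left].
  by case=> /= ->; rewrite -!natr1; lra.
have ME b : hs_martingale p (rcons s b) = hs_martingale p s + D b.
  by rewrite addrC subrK.
rewrite !ME; move: (hs_martingale p s) (D true) (D false) Dmean (Dle true) (Dle false).
move=> M u v uv u9 v9; case/andP: p01 => p0 p1.
have : 0 <= p * (9 - u ^+ 2) + (1 - p) * (9 - v ^+ 2).
  by rewrite addr_ge0 // mulr_ge0 // subr_ge0.
suff -> : p * (M + u) ^+ 2 + (1 - p) * (M + v) ^+ 2 =
  M ^+ 2 + 2 * M * (p * u + (1 - p) * v) + (p * u ^+ 2 + (1 - p) * v ^+ 2).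
  by rewrite uv; lra.
by ring.
Qed.

Lemma bernoulli_mean_hs_martingale_sqr (R : realType) (p : R) n :
  0 <= p <= 1 ->
  bernoulli_mean p n (fun s => hs_martingale p s ^+ 2) <= 9 * n%:R.
Proof.
move=> p01; elim: n => [|n IH] /=.
  by rewrite /hs_martingale /= !mulr0 subrr addr0 expr0n.
apply: le_trans (_ : bernoulli_mean p n
    (fun s => 1 * hs_martingale p s ^+ 2 + 1 * 9) <= _).
  by apply: bernoulli_mean_le => // s _; rewrite !mul1r hs_martingale_sqr_step.
by rewrite bernoulli_mean_linear bernoulli_mean_cst -natr1; lra.
Qed.

(** * Chebyshev's inequality and convergence *)

Lemma hs_deviation_bound (R : realType) (p eps : R) n :
  0 <= p <= 1 -> 0 < eps ->
  bernoulli_mean p n.+1 (fun s =>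
    (eps < `|(HS (butterfly s))%:R / n.+1%:R - hs_rate p|)%R%:R)
  <= 20 / eps ^+ 2 * n.+1%:R^-1.
Proof.
move=> p01 eps0; set N : R := n.+1%:R.
have N1 : 1 <= N by rewrite ler1n.
have N0 : 0 < N by rewrite ltr0n.
have eN0 : 0 < eps * N by rewrite mulr_gt0.
(* The factor 2 comes from [(M - g)^2 <= 2 M^2 + 2 g^2], where [M] is the martingale and [g] the
   potential, bounded by 1. *)
pose a : R := 2 / (eps * N) ^+ 2.
have a0 : 0 <= a by rewrite divr_ge0 // sqr_ge0.
apply: le_trans (_ : bernoulli_mean p n.+1
    (fun s => a * hs_martingale p s ^+ 2 + a * 1) <= _).
  apply: bernoulli_mean_le => // s sn; rewrite -mulrDr.
  case: ltP => [dev|_] /=; last by rewrite mulr_ge0 // addr_ge0 ?sqr_ge0.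
  rewrite /a mulrAC ler_pdivlMr ?exprn_gt0 // mul1r.
  have : eps * N <= `|(HS (butterfly s))%:R - hs_rate p * N|.
    rewrite -ler_pdivlMr // -[X in _ / X](gtr0_norm N0) -normf_div mulrBl.
    by rewrite mulfK ?gt_eqF // ltW.
  rewrite HS_butterfly => devN.
  have -> : hs_martingale p s =
      ((hs_run s).1%:R - hs_rate p * N) + hs_potential p (hs_run s).2.
    by rewrite /hs_martingale sn.
  have := hs_potential_bounds (hs_run s).2 p01.
  move: (_ - _) (hs_potential _ _) devN => u g devN g1.
  have : (eps * N) ^+ 2 <= u ^+ 2.
    by rewrite -[leRHS]real_normK ?num_real // ler_sqr ?nnegrE // ltW.
  have : g ^+ 2 <= 1 by nra.
  (* Indeed [2 (u + g)^2 + 2 g^2 - u^2 = (u + 2 g)^2]. *)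
  by have := sqr_ge0 (u + 2 * g); nra.
rewrite bernoulli_mean_linear bernoulli_mean_cst.
have := bernoulli_mean_hs_martingale_sqr n.+1 p01; rewrite -/N => mM.
apply: le_trans (_ : a * (9 * N + 1) <= _).
  by rewrite mulrDr lerD2r ler_wpM2l.
(* Since [1 <= N], [9 * N + 1 <= 10 * N]; the constant is [2 * 10]. *)
have -> : 20 / eps ^+ 2 * N^-1 = a * (10 * N).
  by rewrite /a; field; rewrite !gt_eqF.
by rewrite ler_wpM2l //; lra.
Qed.

(* The family (x_j), j >= 1, is indexed from 0: [x j] is x_(j+1). *)
Theorem corollary1 (R : realType) (d : measure_display)
    (Omega : measurableType d) (P : probability Omega R) (p : R)
    (x : nat -> {RV P >-> bool}) :
  0 <= p <= 1 ->
  mutually_independent x ->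
  (forall j : nat, distribution P (x j) =1 bernoulli_prob p) ->
  let q := 1 - p in
  cvg_in_probability P
    (fun n w => (HS (butterfly (mkseq (fun j => x j w) n)))%:R / n%:R)
    (cst (p * q / (1 - p * q))).
Proof.
move=> p01 indep distx q eps eps0.
have ub_cvg0 : (20 / eps ^+ 2 * n.+1%:R^-1)%:E @[n --> \oo] --> 0%E.
  apply: cvg_EFin; first exact: nearW.
  rewrite -(mulr0 (20 / eps ^+ 2)).
  by apply: cvgM; [exact: cvg_cst | exact: cvg_harmonic].
(* Shifting to [n.+1] leaves out [n = 0], where the quotient divides by zero. *)
rewrite -cvg_shiftS /=.
apply: squeeze_cvge (cvg_cst 0%E) ub_cvg0; apply: nearW => n.
rewrite measure_ge0 /= (probability_mkseq n.+1 (fun s =>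
  eps < `|(HS (butterfly s))%:R / n.+1%:R - hs_rate p|) p01 indep distx).
by rewrite lee_fin hs_deviation_bound.
Qed.
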